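(* The categories of symmetric kei, Legendrian kei, and involutory racks are equivalent. In fact, good involutions and Legendrian structures coincide for kei: for every kei $R$, the set of good involutions of $R$ equals the set of Legendrian structures on $R$.
   Context: A rack is a pair $R=(X,s)$ where $X$ is a nonempty set and $s:X\to S_X$, $x\mapsto s_x$, is a map to the symmetric group of $X$ with $s_xs_y=s_{s_x(y)}s_x$ for all $x,y\in X$. It is a quandle if $s_x(x)=x$ for all $x$, involutory if $s_x^2=\mathrm{id}_X$ for all $x$, and a kei if it is an involutory quandle. A rack homomorphism $(X,s)\to(Y,t)$ is a map $\varphi$ with $\varphi s_x=t_{\varphi(x)}\varphi$ for all $x$; automorphisms are bijective homomorphisms from a rack to itself. Involutory racks form a full subcategory of the category of racks. A good involution of $(X,s)$ is a map $\rho:X\to X$ with $\rho^2=\mathrm{id}_X$ (identity allowed) such that $\rho s_x=s_x\rho$ and $s_{\rho(x)}=s_x^{-1}$ for all $x$. A symmetric kei is a pair $(R,\rho)$ with $R$ a kei and $\rho$ a good involution of $R$; morphisms $(R_1,\rho_1)\to(R_2,\rho_2)$ are rack homomorphisms $\varphi$ with $\varphi\rho_1=\rho_2\varphi$. A GL-structure on $R=(X,s)$ is a rack automorphism $u$ of $R$ with $us_x=s_xu$ for all $x$; the pair $(R,u)$ is a GL-rack. Morphisms $(R_1,u_1)\to(R_2,u_2)$ of GL-racks are rack homomorphisms $\varphi$ with $\varphi u_1=u_2\varphi$. The canonical automorphism $\theta$ of $R$ is $\theta(x)=s_x(x)$. A GL-rack $(R,u)$ is a Legendrian rack, and $u$ is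 a Legendrian structure on $R$, if $\theta=u^{-2}$ (so if $R$ is a quandle, this says $u^2=\mathrm{id}_X$). A Legendrian kei is a Legendrian rack $(R,u)$ with $R$ a kei; Legendrian kei form a full subcategory of GL-racks. *)

(* Defs.v *)
From HB Require Import structures.
From mathcomp Require Import all_boot.
From mathcomp Require Import boolp classical_sets.

Set Implicit Arguments.
Unset Strict Implicit.
Unset Printing Implicit Defensive.

Local Open Scope group_scope.

(* Morphisms are compared by Leibniz equality, and [compm g f] is "g after f" *)
Record category := Category {
  obj :> Type;
  hom : obj -> obj -> Type;
  idm : forall a, hom a a;
  compm : forall a b c, hom b c -> hom a b -> hom a c;
  comp1m : forall a b (f : hom a b), compm (idm b) f = f;
  compm1 : forall a b (f : hom a b), compm f (idm a) = f;
  compmA : forall a b c d (h : hom c d) (g : hom b c) (f : hom a b),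
    compm h (compm g f) = compm (compm h g) f
}.
Arguments hom {_}.
Arguments idm {_}.
Arguments compm {_ _ _ _}.

Definition is_iso (C : category) (a b : C) (f : hom a b) : Prop :=
  exists g : hom b a, compm g f = idm a /\ compm f g = idm b.

Record functor (C D : category) := Functor {
  fobj :> C -> D;
  fmap : forall a b, hom a b -> hom (fobj a) (fobj b);
  fmap1 : forall a, fmap (idm a) = idm (fobj a);
  fmapM : forall a b c (g : hom b c) (f : hom a b),
    fmap (compm g f) = compm (fmap g) (fmap f)
}.
Arguments fmap {C D} _ {a b}.

Definition id_functor (C : category) : functor C C.
Proof. by exists id (fun _ _ f => f). Defined.

Definition comp_functor (C D E : category) (G : functor D E) (F : functor C D) :
  functor C E.
Proof.
exists (fun a => G (F a)) (fun a b f => fmap G (fmap F f)).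
- by move=> a; rewrite !fmap1.
- by move=> a b c g f; rewrite !fmapM.
Defined.

Record nat_trans (C D : category) (F G : functor C D) := NatTrans {
  component :> forall a, hom (F a) (G a);
  naturality : forall a b (f : hom a b),
    compm (component b) (fmap F f) = compm (fmap G f) (component a)
}.

Definition nat_isomorphic (C D : category) (F G : functor C D) : Prop :=
  exists eta : nat_trans F G, forall a, is_iso (eta a).

Definition equivalent (C D : category) : Prop :=
  exists (F : functor C D) (G : functor D C),
    nat_isomorphic (id_functor C) (comp_functor G F) /\
    nat_isomorphic (comp_functor F G) (id_functor D).

Definition full_subcategory (C : category) (P : C -> Prop) : category.
Proof.
exists {a : C | P a} (fun a b => hom (sval a) (sval b))
  (fun a => idm (sval a)) (fun a b c g f => compm g f).
- by move=> a b f; exact: comp1m.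
- by move=> a b f; exact: compm1.
- by move=> a b c d h g f; exact: compmA.
Defined.

Record symgroup (X : Type) := SymGroup {
  sym_fun :> X -> X;
  sym_inv : X -> X;
  sym_funK : cancel sym_fun sym_inv;
  sym_invK : cancel sym_inv sym_fun
}.

Lemma symgroupP (X : Type) (f g : symgroup X) : f =1 g -> f = g.
Proof.
case: f g => [f f' fK f'K] [g g' gK g'K] /= fg.
have {}fg : f = g by exact: funext.
subst g; have f'g' : f' = g' by apply: funext => x; rewrite -[in LHS](g'K x) fK.
by subst g'; congr SymGroup; exact: Prop_irrelevance.
Qed.

Section SymGroup.
Variable X : Type.
Implicit Types f g h : symgroup X.

Definition sym_one : symgroup X :=
  @SymGroup X id id (fun x => erefl x) (fun x => erefl x).

Definition sym_opp f : symgroup X := SymGroup (@sym_invK X f) (@sym_funK X f).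

(* (f * g) x = f (g x), unlike {perm T}, where products act on the right. *)
Definition sym_mul f g : symgroup X :=
  SymGroup (can_comp (@sym_funK X f) (@sym_funK X g))
           (can_comp (@sym_invK X g) (@sym_invK X f)).

Fact sym_mulA : associative sym_mul.
Proof. by move=> f g h; exact: symgroupP. Qed.
Fact sym_mul1 : left_id sym_one sym_mul.
Proof. by move=> f; exact: symgroupP. Qed.
Fact sym_mulr1 : right_id sym_one sym_mul.
Proof. by move=> f; exact: symgroupP. Qed.
Fact sym_mulV : left_inverse sym_one sym_opp sym_mul.
Proof. by move=> f; apply: symgroupP => x; exact: sym_funK. Qed.
Fact sym_mulrV : right_inverse sym_one sym_opp sym_mul.
Proof. by move=> f; apply: symgroupP => x; exact: sym_invK. Qed.

HB.instance Definition _ := gen_eqMixin (symgroup X).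
HB.instance Definition _ := gen_choiceMixin (symgroup X).
HB.instance Definition _ := isGroup.Build (symgroup X)
  sym_mulA sym_mul1 sym_mulr1 sym_mulV sym_mulrV.

End SymGroup.

Record rack := Rack {
  carrier :> Type;
  rack_nonempty : inhabited carrier;
  rsym : carrier -> symgroup carrier;
  rack_axiom : forall x y, rsym x * rsym y = rsym (rsym x y) * rsym x
}.
Arguments rsym {r}.

Definition is_quandle (R : rack) : Prop := forall x : R, rsym x x = x.

Definition is_involutory (R : rack) : Prop := forall x : R, rsym x ^+ 2 = 1.

Definition is_kei (R : rack) : Prop := is_quandle R /\ is_involutory R.

Definition is_rack_hom (R S : rack) (phi : R -> S) : Prop :=
  forall x : R, phi \o rsym x = rsym (phi x) \o phi.

Definition good_involution (R : rack) (rho : R -> R) : Prop :=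
  [/\ rho \o rho = id,
      forall x, rho \o rsym x = rsym x \o rho
    & forall x, rsym (rho x) = (rsym x)^-1].

Definition gl_structure (R : rack) (u : symgroup R) : Prop :=
  is_rack_hom u /\ forall x : R, u * rsym x = rsym x * u.

Definition canonical_aut (R : rack) : R -> R := fun x => rsym x x.
Arguments canonical_aut : clear implicits.

Definition legendrian_structure (R : rack) (u : symgroup R) : Prop :=
  gl_structure u /\ canonical_aut R = u ^- 2.

Local Open Scope classical_set_scope.

Definition good_involutions (R : rack) : set (R -> R) :=
  [set rho | good_involution rho].
Arguments good_involutions : clear implicits.

(* Self-maps of R rather than elements of its symmetric group, so that they
   can be compared with good involutions. *)
Definition legendrian_structures (R : rack) : set (R -> R) :=
  [set (u : R -> R) | u in [set u : symgroup R | legendrian_structure u]].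
Arguments legendrian_structures : clear implicits.

Local Close Scope classical_set_scope.

Record rack_hom (R S : rack) := RackHom {
  rack_fun :> R -> S;
  rack_funP : is_rack_hom rack_fun
}.

Lemma rack_hom_eq (R S : rack) (f g : rack_hom R S) : f =1 g -> f = g.
Proof.
case: f g => [f fP] [g gP] /= fg.
have {}fg : f = g by exact: funext.
by subst g; congr RackHom; exact: Prop_irrelevance.
Qed.

Fact is_rack_hom_id (R : rack) : is_rack_hom (@id R).
Proof. by []. Qed.

Fact is_rack_hom_comp (R S T : rack) (g : rack_hom S T) (f : rack_hom R S) :
  is_rack_hom (g \o f).
Proof.
move=> x; apply: funext => y /=.
have /(congr1 (fun h => h y)) /= -> := rack_funP f x.
by have /(congr1 (fun h => h (f y))) /= -> := rack_funP g (f x).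
Qed.

Definition rack_id (R : rack) : rack_hom R R := RackHom (@is_rack_hom_id R).
Definition rack_comp (R S T : rack) (g : rack_hom S T) (f : rack_hom R S) :
  rack_hom R T := RackHom (is_rack_hom_comp g f).

Definition rackCat : category.
Proof.
by exists rack rack_hom rack_id rack_comp => *; exact: rack_hom_eq.
Defined.

Definition involutoryRackCat : category :=
  full_subcategory (C := rackCat) is_involutory.

(* Used for the morphisms of symmetric kei as well as those of GL-racks. *)
Record equivariant_hom (R S : rack) (a : R -> R) (b : S -> S) := EquivariantHom {
  eqv_hom :> rack_hom R S;
  eqv_homP : eqv_hom \o a = b \o eqv_hom
}.

Lemma equivariant_hom_eq (R S : rack) (a : R -> R) (b : S -> S)
  (f g : equivariant_hom a b) : f =1 g -> f = g.
Proof.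
case: f g => [f fP] [g gP] /= fg.
have {}fg : f = g by exact: rack_hom_eq.
by subst g; congr EquivariantHom; exact: Prop_irrelevance.
Qed.

Definition equivariant_id (R : rack) (a : R -> R) : equivariant_hom a a.
Proof. by exists (rack_id R). Defined.

Definition equivariant_comp (R S T : rack) (a : R -> R) (b : S -> S) (c : T -> T)
  (g : equivariant_hom b c) (f : equivariant_hom a b) : equivariant_hom a c.
Proof.
exists (rack_comp g f); apply: funext => x /=.
have /(congr1 (fun h => h x)) /= -> := eqv_homP f.
by have /(congr1 (fun h => h (f x))) /= -> := eqv_homP g.
Defined.

Record symmetric_kei := SymmetricKei {
  sk_rack :> rack;
  sk_kei : is_kei sk_rack;
  sk_inv : sk_rack -> sk_rack;
  sk_good : good_involution sk_inv
}.

Definition symmetricKeiCat : category.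
Proof.
by exists symmetric_kei (fun R S => equivariant_hom (@sk_inv R) (@sk_inv S))
  (fun R => equivariant_id (@sk_inv R)) (fun R S T g f => equivariant_comp g f)
  => *; exact: equivariant_hom_eq.
Defined.

Record gl_rack := GLRack {
  gl_base :> rack;
  gl_str : symgroup gl_base;
  gl_strP : gl_structure gl_str
}.

Definition glRackCat : category.
Proof.
by exists gl_rack (fun R S => equivariant_hom (gl_str R) (gl_str S))
  (fun R => equivariant_id (gl_str R)) (fun R S T g f => equivariant_comp g f)
  => *; exact: equivariant_hom_eq.
Defined.

Definition is_legendrian_rack (R : gl_rack) : Prop :=
  legendrian_structure (gl_str R).

Definition legendrianKeiCat : category :=
  full_subcategory (C := glRackCat)
    (fun R : gl_rack => is_legendrian_rack R /\ is_kei R).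

(* Main.v *)
Require Import Defs.
From mathcomp Require Import all_boot.
From mathcomp Require Import boolp classical_sets.

(** On an involutory rack a good involution [rho] satisfies
    [s_(rho x) = s_x], so [x |-> s_x * rho] is again an involutory rack
    structure, [rho] is still a good involution of it, and twisting twice by
    [rho] gives back the original rack.  The canonical automorphism [theta] of
    an involutory rack is a good involution; twisting by it produces a kei.
    Conversely, twisting a kei by a good involution [rho] produces an involutory
    rack with canonical automorphism [rho].  On a kei, a Legendrian structure
    is the same thing as a good involution because [u s_x = s_(u x) u] and
    [u s_x = s_x u] together say [s_(u x) = s_x]. *)

Set Implicit Arguments.
Unset Strict Implicit.
Unset Printing Implicit Defensive.

Local Open Scope group_scope.

(** * Equivalence of categories is symmetric and transitive *)

Lemma nat_isomorphic_sym (C D : category) (F G : functor C D) :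
  nat_isomorphic F G -> nat_isomorphic G F.
Proof.
move=> [eta eta_iso].
(* Being an isomorphism is a mere existence statement, so the inverses are picked by choice. *)
pose inv a := projT1 (cid (eta_iso a)).
have invP a : compm (inv a) (eta a) = idm (F a) /\
              compm (eta a) (inv a) = idm (G a).
  by rewrite /inv; case: cid.
have inv_nat a b (f : hom a b) :
    compm (inv b) (fmap G f) = compm (fmap F f) (inv a).
  (* Insert [eta a] after [inv a] on the right, slide [eta] across by naturality, then cancel it
     against [inv b]. *)
  rewrite -[LHS]compm1 -(invP a).2 -compmA [X in compm _ X]compmA.
  by rewrite -naturality -compmA compmA (invP b).1 comp1m.
exists (NatTrans inv_nat) => a; exists (eta a).
by have [? ?] := invP a.
Qed.

Lemma is_iso_comp (C : category) (a b c : C) (g : hom b c) (f : hom a b) :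
  is_iso g -> is_iso f -> is_iso (compm g f).
Proof.
move=> [g' [g'g gg']] [f' [f'f ff']]; exists (compm f' g'); split.
- by rewrite -compmA [X in compm _ X]compmA g'g comp1m.
- by rewrite -compmA [X in compm _ X]compmA ff' comp1m.
Qed.

Lemma is_iso_fmap (C D : category) (F : functor C D) (a b : C) (f : hom a b) :
  is_iso f -> is_iso (fmap F f).
Proof.
move=> [g [gf fg]]; exists (fmap F g).
by rewrite -!fmapM gf fg !fmap1.
Qed.

Lemma equivalent_sym (C D : category) : equivalent C D -> equivalent D C.
Proof.
by move=> [F [G [GF FG]]]; exists G, F; split; exact: nat_isomorphic_sym.
Qed.

(** The composite unit is [eta] followed by the image under [G] of [eta'] at [F a]. *)
Lemma unit_trans (C D E : category) (F : functor C D) (G : functor D C)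
    (F' : functor D E) (G' : functor E D) :
  nat_isomorphic (id_functor C) (comp_functor G F) ->
  nat_isomorphic (id_functor D) (comp_functor G' F') ->
  nat_isomorphic (id_functor C)
    (comp_functor (comp_functor G G') (comp_functor F' F)).
Proof.
move=> [eta eta_iso] [eta' eta'_iso].
pose comp a : hom (id_functor C a)
    (comp_functor (comp_functor G G') (comp_functor F' F) a) :=
  compm (fmap G (eta' (F a))) (eta a).
have comp_nat a b (f : hom a b) :
    compm (comp b) (fmap (id_functor C) f) =
    compm (fmap (comp_functor (comp_functor G G') (comp_functor F' F)) f)
          (comp a).
  rewrite /comp /=; have /= eta_nat := naturality eta f.
  have /= eta'_nat := naturality eta' (fmap F f).
  by rewrite -compmA eta_nat !compmA -!fmapM eta'_nat.
exists (NatTrans comp_nat) => a.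
by apply: is_iso_comp => //; exact: is_iso_fmap.
Qed.

Lemma equivalent_trans (C D E : category) :
  equivalent C D -> equivalent D E -> equivalent C E.
Proof.
move=> [F [G [GF FG]]] [F' [G' [G'F' F'G']]].
exists (comp_functor F' F), (comp_functor G G'); split.
  exact: unit_trans.
(* Reversed counits are units for the functors taken in the opposite order. *)
by apply: nat_isomorphic_sym; apply: unit_trans; exact: nat_isomorphic_sym.
Qed.

(** * Involutory racks and their good involutions, pointwise *)

Lemma rack_homP (R S : rack) (phi : R -> S) :
  is_rack_hom phi <-> forall x y, phi (rsym x y) = rsym (phi x) (phi y).
Proof.
split=> [h x y|h x]; last by apply: funext => y; exact: h.
exact: (congr1 (fun k => k y) (h x)).
Qed.

Lemma rack_homE (R S : rack) (phi : rack_hom R S) x y :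
  phi (rsym x y) = rsym (phi x) (phi y).
Proof. exact: (rack_homP phi).1 (rack_funP phi) x y. Qed.

Lemma equivariantE (R S : rack) (a : R -> R) (b : S -> S)
  (f : equivariant_hom a b) x : f (a x) = b (f x).
Proof. exact: (congr1 (fun k => k x) (eqv_homP f)). Qed.

Lemma rsym_distr (R : rack) (x y z : R) :
  rsym x (rsym y z) = rsym (rsym x y) (rsym x z).
Proof. exact: (congr1 (fun k : symgroup R => k z) (rack_axiom x y)). Qed.

Lemma sym_involP (X : Type) (f : symgroup X) :
  f ^+ 2 = 1 <-> forall x, f (f x) = x.
Proof.
split=> [h x|h]; first exact: (congr1 (fun k : symgroup X => k x) h).
exact: symgroupP.
Qed.

Lemma sym_inv_invol (X : Type) (f : symgroup X) : f ^+ 2 = 1 -> f^-1 = f.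
Proof. by rewrite expgS expg1 => f2; rewrite -[f^-1]mulg1 -f2 mulKg. Qed.

Lemma involutoryE (R : rack) (iR : is_involutory R) (x y : R) :
  rsym x (rsym x y) = y.
Proof. exact: (sym_involP _).1 (iR x) y. Qed.

Lemma good_involutionP (R : rack) (rho : R -> R) : is_involutory R ->
  good_involution rho <->
  [/\ forall x, rho (rho x) = x,
      forall x y, rho (rsym x y) = rsym x (rho y)
    & forall x, rsym (rho x) = rsym x].
Proof.
move=> iR; split=> [[rho2 rhoC rhoV]|[rho2 rhoC rhoV]].
- split=> [x|x y|x]; first exact: (congr1 (fun k => k x) rho2).
    exact: (congr1 (fun k => k y) (rhoC x)).
  by rewrite rhoV sym_inv_invol.
- split=> [|x|x]; [exact: funext|apply: funext => y; exact: rhoC|].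
  by rewrite rhoV sym_inv_invol.
Qed.

Lemma canonical_aut_good (R : rack) :
  is_involutory R -> good_involution (canonical_aut R).
Proof.
(* The rack axiom at [x], [x] reads [s_x s_x = s_(theta x) s_x]; cancel [s_x]. *)
move=> iR; have sC x : rsym (canonical_aut R x) = rsym x.
  by apply: (mulIg (rsym x)); rewrite /canonical_aut -rack_axiom.
apply/(good_involutionP _ iR); split=> // [x|x y].
- by rewrite [LHS]/canonical_aut sC involutoryE.
- by rewrite /canonical_aut [RHS]rsym_distr.
Qed.

Lemma canonical_aut_hom (R S : rack) (f : rack_hom R S) x :
  f (canonical_aut R x) = canonical_aut S (f x).
Proof. exact: rack_homE. Qed.

Section GoodSym.
Variables (R : rack) (rho : R -> R) (rhoP : good_involution rho).

Lemma good_involutionK : cancel rho rho.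
Proof. by case: rhoP => rho2 _ _ x; exact: (congr1 (fun k => k x) rho2). Qed.

Definition good_sym : symgroup R := SymGroup good_involutionK good_involutionK.

End GoodSym.

(** * Twisting an involutory rack by a good involution *)

Section Twist.
Variables (R : rack) (iR : is_involutory R).
Variables (rho : R -> R) (rhoP : good_involution rho).

Let rhoC x y : rho (rsym x y) = rsym x (rho y).
Proof. by case: ((good_involutionP _ iR).1 rhoP). Qed.

Let rsym_rho x : rsym (rho x) = rsym x.
Proof. by case: ((good_involutionP _ iR).1 rhoP). Qed.

(** Since [rho] commutes with every [s_x] and disappears from subscripts, it can be pulled to the
    front on both sides, leaving self-distributivity of [R]. *)
Fact twist_axiom x y : let s z := rsym z * good_sym rhoP in
  s x * s y = s (s x y) * s x.
Proof.
move=> s; apply: symgroupP => z.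
by rewrite /= -!rhoC rsym_rho rsym_distr.
Qed.

Definition twist : rack := Rack (rack_nonempty R) twist_axiom.

Lemma twistE (x y : twist) : rsym x y = rsym (x : R) (rho y).
Proof. by []. Qed.

Lemma twist_involutory : is_involutory twist.
Proof.
move=> x; apply/sym_involP => y.
by rewrite !twistE rhoC (good_involutionK rhoP) involutoryE.
Qed.

Lemma twist_good : good_involution (rho : twist -> twist).
Proof.
apply/(good_involutionP _ twist_involutory); split=> [x|x y|x].
- exact: good_involutionK rhoP x.
- by rewrite !twistE rhoC.
- by apply: symgroupP => y; rewrite !twistE rsym_rho.
Qed.

(** Here [s_x (rho x) = rho (s_x x) = rho x]. Thus [rho] can be recovered from the twisted rack
    alone. *)
Lemma canonical_aut_twist : is_quandle R -> canonical_aut twist =1 rho.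
Proof. by move=> qR x; rewrite /canonical_aut twistE -rhoC qR. Qed.

End Twist.

Lemma twist_canonical_kei (R : rack) (iR : is_involutory R) :
  is_kei (twist iR (canonical_aut_good iR)).
Proof.
split; last exact: twist_involutory.
by move=> x; rewrite twistE involutoryE.
Qed.

Section TwistHom.
Variables (R S : rack) (iR : is_involutory R) (iS : is_involutory S).
Variables (rho : R -> R) (rhoP : good_involution rho).
Variables (sigma : S -> S) (sigmaP : good_involution sigma).

Lemma twist_is_hom (f : rack_hom R S) : (forall x, f (rho x) = sigma (f x)) ->
  @is_rack_hom (twist iR rhoP) (twist iS sigmaP) f.
Proof.
move=> fC; apply/rack_homP => x y.
exact: etrans (rack_homE f x (rho y)) (congr1 (rsym (f x)) (fC y)).
Qed.

End TwistHom.
Arguments twist_is_hom {R S} iR iS {rho} rhoP {sigma} sigmaP {f}.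

(** * Good involutions versus Legendrian structures on a kei *)

Lemma kei_good_legendrian (R : rack) (kR : is_kei R) (u : symgroup R) :
  good_involution u <-> legendrian_structure u.
Proof.
case: kR => qR iR; split.
- move=> /(good_involutionP _ iR)[u2 uC su]; do !split.
  + by apply/rack_homP => x y; rewrite uC su.
  + by move=> x; apply: symgroupP => y; exact: uC.
  + rewrite (_ : u ^+ 2 = 1); last exact/sym_involP.
    by rewrite invg1; apply: funext => x; exact: qR.
- move=> [[/rack_homP uH uC] uL]; apply/(good_involutionP _ iR); split.
  (* In a quandle [theta] is the identity, so the Legendrian condition says that the inverse of
     [u ^+ 2] is trivial. *)
  + apply/sym_involP; apply: invg_inj; rewrite invg1; apply: symgroupP => x.
    by rewrite -[LHS]/((u ^- 2 : R -> R) x) -uL /canonical_aut qR.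
  + by move=> x y; exact: (congr1 (fun k : symgroup R => k y) (uC x)).
  + move=> x; apply: (mulIg u); rewrite -(uC x); apply: symgroupP => y /=.
    by rewrite uH.
Qed.

Lemma good_involutions_kei (R : rack) : is_kei R ->
  good_involutions R = legendrian_structures R.
Proof.
move=> kR; apply/seteqP; split=> [rho rhoP|_ [u uL <-]].
- by exists (good_sym rhoP) => //; apply/(kei_good_legendrian kR).
- exact/(kei_good_legendrian kR).
Qed.

Lemma legendrian_of_good (R : symmetric_kei) :
  legendrian_structure (good_sym (sk_good R)).
Proof. by apply/(kei_good_legendrian (sk_kei R)); exact: sk_good. Qed.

Definition legendrian_of_symmetric (R : symmetricKeiCat) : legendrianKeiCat :=
  exist (fun R : gl_rack => is_legendrian_rack R /\ is_kei R)
    (GLRack (legendrian_of_good R).1) (conj (legendrian_of_good R) (sk_kei R)).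

Definition symmetric_of_legendrian (R : legendrianKeiCat) : symmetricKeiCat :=
  SymmetricKei (svalP R).2 ((kei_good_legendrian (svalP R).2 _).2 (svalP R).1).

(** Both categories use [equivariant_hom] over the same underlying maps, so morphisms are left
    untouched. A round trip alters only proofs and the stored inverse of [u], hence identity maps
    serve as unit and counit. *)
Definition legendrian_functor : functor symmetricKeiCat legendrianKeiCat.
Proof.
by exists legendrian_of_symmetric
  (fun R S (f : equivariant_hom (@sk_inv R) (@sk_inv S)) => f).
Defined.

Definition symmetric_functor : functor legendrianKeiCat symmetricKeiCat.
Proof.
by exists symmetric_of_legendrian
  (fun R S (f : equivariant_hom (gl_str (sval R)) (gl_str (sval S))) => f).
Defined.

Lemma symmetric_legendrian_equivalent :
  equivalent symmetricKeiCat legendrianKeiCat.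
Proof.
exists legendrian_functor, symmetric_functor; split.
- unshelve eexists.
    exists (fun R : symmetric_kei => equivariant_id (@sk_inv R)) => R S f.
    exact: equivariant_hom_eq.
  move=> R; exists (equivariant_id (@sk_inv R)).
  by split; exact: equivariant_hom_eq.
- unshelve eexists.
    exists (fun R : legendrianKeiCat => equivariant_id (gl_str (sval R))).
    by move=> R S f; exact: equivariant_hom_eq.
  move=> R; exists (equivariant_id (gl_str (sval R))).
  by split; exact: equivariant_hom_eq.
Qed.

(** * Symmetric kei versus involutory racks *)

Definition involutory_of_symmetric (R : symmetricKeiCat) : involutoryRackCat :=
  exist is_involutory (twist (sk_kei R).2 (sk_good R)) (@twist_involutory _ _ _ _).

Definition symmetric_of_involutory (R : involutoryRackCat) : symmetricKeiCat :=
  SymmetricKei (twist_canonical_kei (svalP R))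
    (twist_good (svalP R) (canonical_aut_good (svalP R))).

Definition involutory_functor : functor symmetricKeiCat involutoryRackCat.
Proof.
exists involutory_of_symmetric
  (fun (R S : symmetric_kei) (f : equivariant_hom (@sk_inv R) (@sk_inv S)) =>
     RackHom (twist_is_hom (sk_kei R).2 (sk_kei S).2 (sk_good R) (sk_good S)
                           (equivariantE f)));
by move=> *; exact: rack_hom_eq.
Defined.

(** Equivariance comes for free: every rack homomorphism commutes with the canonical
    automorphisms. *)
Definition twist_functor_hom (R S : involutoryRackCat)
    (f : rack_hom (sval R) (sval S)) :
  equivariant_hom (@sk_inv (symmetric_of_involutory R))
                  (@sk_inv (symmetric_of_involutory S)).
Proof.
exists (RackHom (twist_is_hom (svalP R) (svalP S) (canonical_aut_good (svalP R))
   (canonical_aut_good (svalP S)) (canonical_aut_hom f))).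
by apply: funext => x; exact: (canonical_aut_hom f).
Defined.

Definition twist_functor : functor involutoryRackCat symmetricKeiCat.
Proof.
by exists symmetric_of_involutory twist_functor_hom;
  move=> *; exact: equivariant_hom_eq.
Defined.

Section Unit.
Variable R : symmetric_kei.
Let R' : symmetric_kei := symmetric_of_involutory (involutory_of_symmetric R).

(** The round trip twists by [rho], then by the canonical automorphism of the result, which is again
    [rho]; the two cancel. The identity map is therefore an isomorphism from [R] to [R']. *)
Lemma rsym_unit (x y : R) : @rsym R' x y = @rsym R x y.
Proof.
pose theta := canonical_aut (twist (sk_kei R).2 (sk_good R)).
(* Both twists unfold by conversion. *)
rewrite -[LHS]/(@rsym R x (sk_inv (theta y))).
by rewrite /theta (canonical_aut_twist (sk_kei R).1) (good_involutionK (sk_good R)).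
Qed.

Lemma sk_inv_unit : @sk_inv R' = @sk_inv R.
Proof. exact: funext (canonical_aut_twist (sk_kei R).1). Qed.

Definition unit_to : equivariant_hom (@sk_inv R) (@sk_inv R').
Proof.
unshelve eexists; first exists (id : R -> R').
  by apply/rack_homP => x y; rewrite rsym_unit.
by rewrite sk_inv_unit.
Defined.

Definition unit_from : equivariant_hom (@sk_inv R') (@sk_inv R).
Proof.
unshelve eexists; first exists (id : R' -> R).
  by apply/rack_homP => x y; rewrite rsym_unit.
by rewrite sk_inv_unit.
Defined.

End Unit.

Section Counit.
Variables (R : rack) (iR : is_involutory R).
Let R' : rack :=
  sval (involutory_of_symmetric (symmetric_of_involutory (exist _ R iR))).

(** Both twists are by the canonical automorphism of [R], which squares to the identity. *)
Lemma rsym_counit (x y : R) : @rsym R' x y = @rsym R x y.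
Proof.
rewrite -[LHS]/(@rsym R x (canonical_aut R (canonical_aut R y))).
by rewrite (good_involutionK (canonical_aut_good iR)).
Qed.

Definition counit_to : rack_hom R' R.
Proof.
by exists (id : R' -> R); apply/rack_homP => x y; rewrite rsym_counit.
Defined.

Definition counit_from : rack_hom R R'.
Proof.
by exists (id : R -> R'); apply/rack_homP => x y; rewrite rsym_counit.
Defined.

End Counit.

Lemma symmetric_involutory_equivalent :
  equivalent symmetricKeiCat involutoryRackCat.
Proof.
exists involutory_functor, twist_functor; split.
- unshelve eexists.
    by exists unit_to => R S f; exact: equivariant_hom_eq.
  by move=> R; exists (unit_from R); split; exact: equivariant_hom_eq.
- unshelve eexists.
    unshelve eexists; first by case=> R iR; exact: counit_to iR.
    by move=> [R iR] [S iS] f; exact: rack_hom_eq.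
  by move=> [R iR]; exists (counit_from iR); split; exact: rack_hom_eq.
Qed.

Theorem theorem1p10 :
  (equivalent symmetricKeiCat legendrianKeiCat /\
   equivalent legendrianKeiCat involutoryRackCat /\
   equivalent symmetricKeiCat involutoryRackCat) /\
  (forall R : rack, is_kei R -> good_involutions R = legendrian_structures R).
Proof.
have sl := symmetric_legendrian_equivalent.
have si := symmetric_involutory_equivalent.
split; last exact: good_involutions_kei.
(* The remaining equivalence passes through symmetric kei. *)
by split=> //; split=> //; apply: equivalent_trans si; exact: equivalent_sym.
Qed.
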